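(* Let $p<q<r$ be odd primes and let $\Psi_{pqr}(x)=(x^{pqr}-1)/\Phi_{pqr}(x)$. Then $$h(\Psi_{pqr}(x))\le\Big\lfloor\frac{(p-1)(q-1)}{r}\Big\rfloor+1,$$ and in particular $h(\Psi_{pqr}(x))\le p-1$.
   Context: $\Phi_n(x)$ denotes the $n$-th cyclotomic polynomial and $\Psi_n(x)=(x^n-1)/\Phi_n(x)=\prod_{1\le j\le n,\ \gcd(j,n)>1}(x-\zeta_n^j)\in\mathbb Z[x]$, with $\zeta_n$ a primitive $n$-th root of unity. The height $h(f)$ of $f\in\mathbb Z[x]$ is the maximum absolute value of its coefficients. *)

(* Defs.v *)
From mathcomp Require Import all_boot all_order all_algebra all_field.

Set Implicit Arguments.
Unset Strict Implicit.
Unset Printing Implicit Defensive.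

Import Order.TTheory GRing.Theory Num.Theory.
Local Open Scope ring_scope.

(* [%/] on [{poly int}] is pseudo-division; as ['Phi_n] is monic it is the
   Euclidean division, and the quotient is exact ([inv_cyclotomicK]). *)
Definition inv_cyclotomic (n : nat) : {poly int} := ('X^n - 1) %/ 'Phi_n.

Lemma inv_cyclotomicK (n : nat) :
  (0 < n)%N -> inv_cyclotomic n * 'Phi_n = 'X^n - 1.
Proof.
move=> n_gt0; rewrite /inv_cyclotomic -(prod_Cyclotomic n_gt0).
rewrite (big_rem n) ?divisors_id //= mulrC.
by rewrite [X in X %/ _]mulrC Pdiv.IdomainMonic.mulpK ?Cyclotomic_monic // mulrC.
Qed.

Definition height (f : {poly int}) : nat := (\max_(i < size f) `|(f`_i)%R|)%N.

(* Main.v *)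
Require Import Defs.
From mathcomp Require Import all_boot all_order all_algebra all_field.
From mathcomp Require Import zify ring.

(* Comparing the factorizations into cyclotomic polynomials gives
     Psi_pqr(X) = Phi_pq(X) * Psi_pq(X^r),
   where Psi_pq = (1 + X + ... + X^(p-1)) (X^q - 1). Both Phi_pq and Psi_pq have
   all their coefficients in {-1, 0, 1}, and Phi_pq has degree (p-1)(q-1), so the
   n-th coefficient of Psi_pqr is a sum of terms of absolute value at most 1, one
   for each k with 0 <= n - r k <= (p-1)(q-1); there are at most
   (p-1)(q-1) %/ r + 1 of these. *)

Set Implicit Arguments.
Unset Strict Implicit.
Unset Printing Implicit Defensive.

Import Order.TTheory GRing.Theory Num.Theory.
Local Open Scope ring_scope.

Definition flat (f : {poly int}) : Prop := forall i, `|f`_i| <= 1.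

Lemma height_leP (f : {poly int}) (m : nat) :
  (forall i, `|f`_i| <= m%:Z) -> (height f <= m)%N.
Proof. by move=> f_le; apply/bigmax_leqP => i _; have := f_le i; lia. Qed.

Lemma Xn_sub1_neq0 (n : nat) : (0 < n)%N -> 'X^n - 1 != 0 :> {poly int}.
Proof. by move=> n_gt0; rewrite -size_poly_eq0 size_XnsubC. Qed.

(** Modulo [p] the equation gives [p %| q * (i' - i)], hence [p %| i' - i] by coprimality, and
    [i' - i] is less than [p]. Ordering [i] and [i'] first makes the truncated subtraction exact. *)
Lemma linear_comb_inj (p q i i' j j' : nat) : coprime p q ->
  (i < p)%N -> (i' < p)%N -> (q * i + p * j = q * i' + p * j')%N ->
  i = i' /\ j = j'.
Proof.
move=> co_pq; wlog le_ii' : i i' j j' / (i <= i')%N => [th | lt_i lt_i' E].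
  move=> lt_i lt_i' E; have [/th | /ltnW/th] := leqP i i'; first exact.
  by case/(_ j' j lt_i' lt_i (esym E)).
have : (p %| q * (i' - i))%N.
  have -> : (q * (i' - i) = p * (j - j'))%N by rewrite !mulnBr; lia.
  exact: dvdn_mulr.
rewrite Gauss_dvdr // => p_dv.
have Ei : i = i'.
  have [| /dvdn_leq/(_ p_dv)] := posnP (i' - i); lia.
split=> //; move: E; rewrite Ei => /eqP.
by rewrite eqn_add2l eqn_pmul2l ?(leq_ltn_trans _ lt_i) // => /eqP.
Qed.

(** The two lists separate the divisors prime to [p], which divide [m], from the multiples of [p].
    They are disjoint since [p] does not divide [m]. *)
Lemma divisors_mul_prime (m p : nat) : (0 < m)%N -> prime p -> ~~ (p %| m)%N ->
  perm_eq (divisors (m * p)) (divisors m ++ [seq (d * p)%N | d <- divisors m]).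
Proof.
move=> m_gt0 p_pr pNm; have p_gt0 := prime_gt0 p_pr.
have mp_gt0 : (0 < m * p)%N by rewrite muln_gt0 m_gt0.
apply: uniq_perm; first exact: divisors_uniq.
  rewrite cat_uniq divisors_uniq map_inj_uniq ?divisors_uniq ?andbT /=; last first.
    by move=> d e /eqP; rewrite eqn_pmul2r // => /eqP.
  apply/hasPn => _ /mapP[d _ ->]; rewrite -dvdn_divisors //.
  by apply: contra pNm; apply: dvdn_trans; rewrite dvdn_mull.
move=> d; rewrite mem_cat -!dvdn_divisors //.
apply/idP/orP => [d_dv | [d_dv | /mapP[e]]]; last first.
- by rewrite -dvdn_divisors // => e_dv ->; rewrite dvdn_pmul2r.
- exact: dvdn_mulr.
have [p_dv | pNd] := boolP (p %| d)%N; last first.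
  by left; rewrite -(@Gauss_dvdl _ _ p) // coprime_sym prime_coprime.
right; apply/mapP; exists (d %/ p)%N; last by rewrite divnK.
by rewrite -dvdn_divisors // -(dvdn_pmul2r p_gt0) divnK.
Qed.

Lemma Xn_sub1_mul_prime (m p : nat) : (0 < m)%N -> prime p -> ~~ (p %| m)%N ->
  'X^(m * p) - 1 = ('X^m - 1) * \prod_(d <- divisors m) 'Phi_(d * p).
Proof.
move=> m_gt0 p_pr pNm; have p_gt0 := prime_gt0 p_pr.
rewrite -!prod_Cyclotomic ?muln_gt0 ?m_gt0 //.
by rewrite (perm_big _ (divisors_mul_prime m_gt0 p_pr pNm)) big_cat big_map.
Qed.

Lemma prod_divisors_prime (F : nat -> {poly int}) (p : nat) : prime p ->
  \prod_(d <- divisors p) F d = F 1%N * F p.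
Proof.
move=> p_pr; have pN1 : ~~ (p %| 1)%N by rewrite dvdn1 neq_ltn prime_gt1 ?orbT.
have E := divisors_mul_prime (ltn0Sn 0) p_pr pN1; rewrite mul1n in E.
rewrite (perm_big _ E).
by rewrite big_cat big_map !big_seq1 mul1n.
Qed.

Lemma Xn_sub1_prime (p : nat) : prime p -> 'X^p - 1 = ('X - 1) * 'Phi_p.
Proof.
move=> p_pr; rewrite -prod_Cyclotomic ?prime_gt0 // prod_divisors_prime //.
by have := prod_Cyclotomic (ltn0Sn 0); rewrite big_seq1 => ->.
Qed.

Lemma Xn_sub1_two_primes (p q : nat) : prime p -> prime q -> p != q ->
  'X^(p * q) - 1 = ('X^p - 1) * 'Phi_q * 'Phi_(p * q).
Proof.
move=> p_pr q_pr pq; rewrite Xn_sub1_mul_prime ?prime_gt0 //; last first.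
  by rewrite dvdn_prime2 // eq_sym.
by rewrite prod_divisors_prime // mul1n mulrA.
Qed.

Lemma Xn_sub1_three_primes (p q r : nat) :
  prime p -> prime q -> prime r -> p != q -> p != r -> q != r ->
  'X^(p * q * r) - 1 =
    ('X^(p * q) - 1) * 'Phi_r * 'Phi_(p * r) * 'Phi_(q * r) * 'Phi_(p * q * r).
Proof.
move=> p_pr q_pr r_pr pq pr qr.
have pq_gt0 : (0 < p * q)%N by rewrite muln_gt0 !prime_gt0.
have rNpq : ~~ (r %| p * q)%N.
  by rewrite Euclid_dvdM // !dvdn_prime2 // ![r == _]eq_sym negb_or pr.
rewrite Xn_sub1_mul_prime // (perm_big _ (divisors_mul_prime _ _ _)) ?prime_gt0 //.
  rewrite big_cat big_map /= !prod_divisors_prime // !mul1n; ring.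
by rewrite dvdn_prime2 // eq_sym.
Qed.

Lemma totient_prime_mul (p q : nat) : prime p -> prime q -> p != q ->
  totient (p * q) = (p.-1 * q.-1)%N.
Proof.
move=> p_pr q_pr pq.
by rewrite totient_coprime ?totient_prime // prime_coprime // dvdn_prime2.
Qed.

Lemma sum_Xn (n : nat) : \sum_(i < n) 'X^i = \poly_(i < n) 1 :> {poly int}.
Proof. by rewrite poly_def; apply: eq_bigr => i _; rewrite scale1r. Qed.

Definition inv_cyclotomic2 (p q : nat) : {poly int} :=
  (\sum_(i < p) 'X^i) * ('X^q - 1).

(** Each coefficient is a difference of two coefficients of [\poly_(i < p) 1], or of such a
    coefficient and 0. *)
Lemma flat_inv_cyclotomic2 (p q : nat) : flat (inv_cyclotomic2 p q).
Proof.
move=> k; rewrite /inv_cyclotomic2 sum_Xn mulrBr mulr1 coefB coefMXn !coef_poly.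
by do 3?case: ifP.
Qed.

(** This is Psi_pq = (X^p - 1)(X^q - 1) / (X - 1), cleared of its denominator, with X^r substituted
    for X. *)
Lemma inv_cyclotomic2_Xn (p q r : nat) :
  (inv_cyclotomic2 p q \Po 'X^r) * ('X^r - 1) =
  ('X^(p * r) - 1) * ('X^(q * r) - 1).
Proof.
have E : inv_cyclotomic2 p q * ('X - 1) = ('X^p - 1) * ('X^q - 1).
  by rewrite /inv_cyclotomic2 [X in _ = X * _]subrX1; ring.
have := congr1 (comp_poly 'X^r) E.
rewrite !(comp_polyM, comp_polyB, comp_polyX, comp_polyC, comp_Xn_poly).
by rewrite -!exprM ![(r * _)%N]mulnC.
Qed.

Lemma inv_cyclotomic_three_primes (p q r : nat) :
  prime p -> prime q -> prime r -> p != q -> p != r -> q != r ->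
  inv_cyclotomic (p * q * r) = 'Phi_(p * q) * (inv_cyclotomic2 p q \Po 'X^r).
Proof.
move=> p_pr q_pr r_pr pq pr qr.
have pqr_gt0 : (0 < p * q * r)%N by rewrite !muln_gt0 !prime_gt0.
have Phi_neq0 : 'Phi_(p * q * r) != 0 by rewrite monic_neq0 ?Cyclotomic_monic.
(* After multiplication by X^r - 1 and Phi_pqr, both sides are the same product of X - 1, X^p - 1
   and cyclotomic polynomials, up to order. *)
apply: (mulIf (Xn_sub1_neq0 (prime_gt0 r_pr))).
rewrite -mulrA inv_cyclotomic2_Xn.
apply: (mulIf Phi_neq0); rewrite mulrAC inv_cyclotomicK //.
rewrite Xn_sub1_three_primes // !Xn_sub1_two_primes // (Xn_sub1_prime q_pr).
by rewrite (Xn_sub1_prime r_pr); ring.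
Qed.

(** The double sum is the product of the geometric sums (X^(pq) - 1)/(X^q - 1) and (X^(pq) - 1)/(X^p
    - 1), while Phi_pq = (X^(pq) - 1)(X - 1) / ((X^p - 1)(X^q - 1)). *)
Lemma cyclotomic_two_primesE (p q : nat) : prime p -> prime q -> p != q ->
  'Phi_(p * q) * ('X^(p * q) - 1) =
  ('X - 1) * \sum_(u : 'I_p * 'I_q) 'X^(q * u.1 + p * u.2).
Proof.
move=> p_pr q_pr pq; have [p_gt0 q_gt0] := (prime_gt0 p_pr, prime_gt0 q_pr).
have -> : \sum_(u : 'I_p * 'I_q) 'X^(q * u.1 + p * u.2) =
    (\sum_(i < p) 'X^q ^+ i) * (\sum_(j < q) 'X^p ^+ j) :> {poly int}.
  rewrite big_distrlr pair_big /=.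
  by apply: eq_bigr => u _; rewrite -!exprM exprD.
apply: (mulIf (Xn_sub1_neq0 p_gt0)); apply: (mulIf (Xn_sub1_neq0 q_gt0)).
have Ep := subrX1 ('X^q : {poly int}) p; have Eq := subrX1 ('X^p : {poly int}) q.
rewrite -exprM mulnC in Ep; rewrite -exprM in Eq.
transitivity (('X - 1) * ('X^(p * q) - 1) * ('X^(p * q) - 1) : {poly int}).
  by rewrite Xn_sub1_two_primes // (Xn_sub1_prime q_pr); ring.
by rewrite {1}Ep Eq; ring.
Qed.

(* Below the degree p q, the product of Phi_pq by X^(pq) - 1 is -Phi_pq, while
   each n has at most one representation n = q i + p j with i < p and j < q. *)
Lemma flat_cyclotomic_two_primes (p q : nat) : prime p -> prime q -> p != q ->
  flat 'Phi_(p * q).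
Proof.
move=> p_pr q_pr pq; have [p_gt0 q_gt0] := (prime_gt0 p_pr, prime_gt0 q_pr).
have co_pq : coprime p q by rewrite prime_coprime // dvdn_prime2.
pose S : {poly int} := \sum_(u : 'I_p * 'I_q) 'X^(q * u.1 + p * u.2).
have S01 n : 0 <= S`_n <= 1.
  (* The coefficient counts the representations of [n], of which there is at most one. *)
  have -> : S`_n = #|[pred u : 'I_p * 'I_q | n == (q * u.1 + p * u.2)%N]|%:Z.
    rewrite coef_sum -sum1_card -[Posz _]natz natr_sum [RHS]big_mkcond /=.
    by apply: eq_bigr => u _; rewrite coefXn inE; case: eqP.
  suff : (#|[pred u : 'I_p * 'I_q | n == (q * u.1 + p * u.2)%N]| <= 1)%N.
    by rewrite lez_nat.
  apply/card_le1_eqP => -[i j] [i' j'] /= /eqP -> /eqP E.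
  have [Ei Ej] := linear_comb_inj co_pq (ltn_ord i) (ltn_ord i') E.
  by congr pair; apply: val_inj.
move=> n; have [n_ge | n_lt] := leqP (p * q) n.
  rewrite nth_default ?normr0 // size_Cyclotomic totient_prime_mul //.
  by apply: leq_trans n_ge; rewrite ltn_mul ?ltn_predL.
(* Taking coefficients at [n] yields -Phi_n = S_(n-1) - S_n, where S_(-1) is read as 0; hence the
   separate case [n = 0]. *)
have := congr1 (fun f : {poly int} => f`_n) (cyclotomic_two_primesE p_pr q_pr pq).
rewrite -/S mulrBr mulr1 coefB coefMXn n_lt mulrBl mul1r coefB coefXM sub0r.
have sub01 (a b c : int) : 0 <= a <= 1 -> 0 <= b <= 1 -> - c = a - b -> `|c| <= 1.
  by lia.
by case: n {n_lt} => [|n] /=; [apply: (sub01 0) | apply: (sub01 S`_n)].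
Qed.

Lemma coef_mul_comp_Xn (f g : {poly int}) (r n : nat) :
  (f * (g \Po 'X^r))`_n =
  \sum_(k < size g | (r * k <= n)%N) g`_k * f`_(n - r * k).
Proof.
rewrite comp_polyE mulr_sumr coef_sum [RHS]big_mkcond; apply: eq_bigr => k _.
by rewrite -scalerAr coefZ -exprM coefMXn; case: ltnP; rewrite ?mulr0.
Qed.

(** Dividing the inequalities by [r] puts [k] between [n %/ r - d %/ r] and [n %/ r]. If the
    subtraction truncates to 0, the interval listed by [iota] still reaches [n %/ r]. *)
Lemma card_multiples_window (m r d n : nat) : (0 < r)%N ->
  (#|[pred k : 'I_m | (r * k <= n <= r * k + d)%N]| <= d %/ r + 1)%N.
Proof.
move=> r_gt0; rewrite cardE -(size_map val).
rewrite -[leqRHS](size_iota (n %/ r - d %/ r)); apply: uniq_leq_size.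
  by rewrite map_inj_uniq ?enum_uniq //; apply: val_inj.
move=> i /mapP[k]; rewrite mem_enum => /andP[/= rk_le le_rk] ->{i}.
have le1 : (k <= n %/ r)%N by rewrite leq_divRL // mulnC.
suff : (n %/ r <= k + d %/ r)%N by rewrite mem_iota /=; lia.
apply: leq_trans (leq_div2r r le_rk) _.
by rewrite mulnC divnMDl.
Qed.

Lemma coef_mul_comp_Xn_le (f g : {poly int}) (d r n : nat) : (0 < r)%N ->
  flat f -> flat g -> (size f <= d.+1)%N ->
  `|(f * (g \Po 'X^r))`_n| <= (d %/ r + 1)%N%:Z.
Proof.
move=> r_gt0 f_flat g_flat size_f; rewrite coef_mul_comp_Xn.
apply: le_trans (ler_norm_sum _ _ _) _.
apply: (@le_trans _ _ (\sum_(k < size g | (r * k <= n <= r * k + d)%N) 1)).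
  rewrite big_mkcond [leRHS]big_mkcond; apply: ler_sum => k _ /=.
  case: leqP => //= rk_le; case: leqP => [_ | d_lt].
    by rewrite normrM mulr_ile1 ?f_flat ?g_flat.
  (* Here [n - r * k] exceeds [d], so the coefficient of [f] lies beyond its size and vanishes. *)
  rewrite [f`__]nth_default ?mulr0 ?normr0 //.
  by apply: leq_trans size_f _; rewrite ltn_subRL.
by rewrite sumr_const natz lez_nat card_multiples_window.
Qed.

Local Close Scope ring_scope.

Theorem theorem1 (p q r : nat)
  (p_prime : prime p) (q_prime : prime q) (r_prime : prime r)
  (p_odd : odd p) (q_odd : odd q) (r_odd : odd r)
  (lt_pq : p < q) (lt_qr : q < r) :
  height (inv_cyclotomic (p * q * r)) <= ((p - 1) * (q - 1)) %/ r + 1 /\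
  height (inv_cyclotomic (p * q * r)) <= p - 1.
Proof.
have [p_gt1 q_gt1] := (prime_gt1 p_prime, prime_gt1 q_prime).
have neq_pq : p != q by rewrite neq_ltn lt_pq.
have neq_pr : p != r by rewrite neq_ltn (ltn_trans lt_pq).
have neq_qr : q != r by rewrite neq_ltn lt_qr.
have height_le :
    height (inv_cyclotomic (p * q * r)) <= ((p - 1) * (q - 1)) %/ r + 1.
  apply: height_leP => n; rewrite inv_cyclotomic_three_primes //.
  apply: coef_mul_comp_Xn_le; first exact: prime_gt0.
  - exact: flat_cyclotomic_two_primes.
  - exact: flat_inv_cyclotomic2.
  - by rewrite size_Cyclotomic totient_prime_mul // !subn1.
split=> //; apply: leq_trans height_le _.
(* As [q - 1 < r], the numerator is less than [(p - 1) * r]; the strict inequality absorbs the [+ 1]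
   of the first bound. *)
have : (p - 1) * (q - 1) %/ r < p - 1; last by lia.
rewrite ltn_divLR ?prime_gt0 // ltn_pmul2l; lia.
Qed.
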